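(* Let $\mathbf{M}\subseteq\Sigma^*$ be any language and let $\mathbf{t}$ be an input-decreasing transducer over $\Sigma$ (with respect to a fixed total order $\prec$ on $\Sigma^*$ as in the context). If a language $L\subseteq\mathbf{M}$ is $\mathbf{t}$-independent, then the language $\mu^*L=\bigcup_{i\ge 0}\mu^iL$ contains $L$ and is maximal $\mathbf{t}$-independent (relative to $\mathbf{M}$).
   Context: $\Sigma$ is an alphabet (finite nonempty set) and $\Sigma^*$ is the set of all words over it. $\mathbf{M}\subseteq\Sigma^*$ is a fixed arbitrary language. Fix a total order $\prec$ (strict) on $\Sigma^*$ such that every word $w$ has a position $\mathrm{pos}(w)\in\{0,1,2,\ldots\}$, the number of words strictly smaller than $w$ (so every word has only finitely many predecessors). A transducer $\mathbf{t}$ over $\Sigma$ is a finite transducer $(Q,\Sigma,T,I,F)$ with finite transition set $T\subseteq Q\times\Sigma^*\times\Sigma^*\times Q$ and sets $I,F\subseteq Q$ of initial and final states; it realizes the relation $R(\mathbf{t})\subseteq\Sigma^*\times\Sigma^*$ of labels of its accepting paths. Write $y\in\mathbf{t}(x)$ iff $(x,y)\in R(\mathbf{t})$, $\mathbf{t}(X)=\bigcup_{x\in X}\mathbf{t}(x)$ for a language $X$, and $\mathbf{t}^{-1}$ for the transducer realizing the inverse relation. $\mathbf{t}$ is input-decreasing if $y\in\mathbf{t}(x)$ implies $y\prec x$, for all words $x,y$. A language $L$ is $\mathbf{t}$-independent if $\mathbf{t}(L)\cap L=\emptyset$. A $\mathbf{t}$-independent $L\subseteq\mathbf{M}$ is maximal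 $\mathbf{t}$-independent (relative to $\mathbf{M}$) if $L\cup\{w\}$ is not $\mathbf{t}$-independent for every $w\in\mathbf{M}\setminus L$. For any language $X$: $\mathrm{I}(X)=\mathbf{M}\setminus(\mathbf{t}(X)\cup\mathbf{t}^{-1}(X))$ and $\mu X=\mathrm{I}(X)\setminus\mathbf{t}^{-1}(\mathrm{I}(X))$. Moreover $\mu^0X=X$ and $\mu^{i+1}X=\mu(\mu^iX)$. *)

(* Defs.v *)
From HB Require Import structures.
From mathcomp Require Import all_boot.
From mathcomp Require Import finmap.
From mathcomp Require Import all_classical.

Set Implicit Arguments.
Unset Strict Implicit.
Unset Printing Implicit Defensive.

Local Open Scope classical_set_scope.

Notation language Sigma := (set (seq Sigma)).

Section WordOrder.
Variable (Sigma : finType) (prec : seq Sigma -> seq Sigma -> Prop).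

Definition strict_total_order : Prop :=
  [/\ forall u, ~ prec u u,
      forall u v w, prec u v -> prec v w -> prec u w
    & forall u v, [\/ prec u v, u = v | prec v u]].

(* [finite_set A] unfolds to [exists n, A #= `I_n]; for A the predecessors of
   w, such an n is the position of w. *)
Definition has_positions : Prop := forall w, finite_set [set u | prec u w].

End WordOrder.

Section Transducers.
Variable Sigma : finType.

Record transducer := Transducer {
  state : finType;
  trans : {fset state * seq Sigma * seq Sigma * state};
  initial : {set state};
  final : {set state}
}.

(* [run t p x y q]: some (possibly empty) path of t from p to q is labelled by
   (x, y), the componentwise concatenation of its transition labels. *)
Inductive run (t : transducer) :
  state t -> seq Sigma -> seq Sigma -> state t -> Prop :=
| run_nil p : run p [::] [::] p
| run_cons p u v q x y r :
    (p, u, v, q) \in trans t -> run q x y r -> run p (u ++ x) (v ++ y) r.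

Definition realizes (t : transducer) : set (seq Sigma * seq Sigma) :=
  [set xy | exists p q : state t,
     [/\ p \in initial t, q \in final t & run p xy.1 xy.2 q]].

Definition tout (t : transducer) (x : seq Sigma) : language Sigma :=
  [set y | realizes t (x, y)].

Definition timage (t : transducer) (X : language Sigma) : language Sigma :=
  \bigcup_(x in X) tout t x.

Definition swap_trans (Q : Type) (e : Q * seq Sigma * seq Sigma * Q) :
    Q * seq Sigma * seq Sigma * Q :=
  let: (p, u, v, q) := e in (p, v, u, q).

Definition tinv (t : transducer) : transducer :=
  @Transducer (state t) [fset swap_trans e | e in trans t]%fset
    (initial t) (final t).

Lemma realizes_tinv t x y : realizes (tinv t) (x, y) <-> realizes t (y, x).
Proof.
split=> -[p [q [Ip Fq /= r]]]; exists p, q; split=> //=.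
- elim: {Ip Fq} r => {p q}[p|p u v q x' y' r' e _ IH]; first exact: (@run_nil t).
  apply: (@run_cons t) IH; case/imfsetP: e => -[[[p1 u1] v1] q1] /= e.
  by case=> -> -> -> ->.
- elim: {Ip Fq} r => {p q}[p|p u v q x' y' r' e _ IH].
    exact: (@run_nil (tinv t)).
  apply: (@run_cons (tinv t)) IH; apply/imfsetP.
  by exists (p, u, v, q).
Qed.

Definition input_decreasing (prec : seq Sigma -> seq Sigma -> Prop)
    (t : transducer) : Prop :=
  forall x y, tout t x y -> prec y x.

Definition independent (t : transducer) (L : language Sigma) : Prop :=
  timage t L `&` L = set0.

Definition maximal_independent (M : language Sigma) (t : transducer)
    (L : language Sigma) : Prop :=
  [/\ L `<=` M, independent t L
    & forall w, (M `\` L) w -> ~ independent t (L `|` [set w])].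

Definition indep_ext (M : language Sigma) (t : transducer)
    (X : language Sigma) : language Sigma :=
  M `\` (timage t X `|` timage (tinv t) X).

Definition mu (M : language Sigma) (t : transducer) (X : language Sigma) :
    language Sigma :=
  indep_ext M t X `\` timage (tinv t) (indep_ext M t X).

Definition mu_star (M : language Sigma) (t : transducer) (X : language Sigma) :
    language Sigma :=
  \bigcup_i iter i (mu M t) X.

End Transducers.

(* Main.v *)
(** If [mu^i L] settles every predecessor of [w], meaning that it contains that
    predecessor or is incompatible with it, then [mu^(i+1) L] settles [w]: were
    [w] compatible with [mu^i L] but rejected by [mu], some [z] in [t(w)] would
    be compatible with [mu^i L]; as [z] precedes [w], it would belong to
    [mu^i L], making [w] incompatible with [mu^i L].  Since [w] has finitely
    many predecessors and the sets [mu^i L] increase, well-founded induction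
    shows that every word of [M] is settled at a finite stage. *)
Require Import Defs.
From mathcomp Require Import all_boot.
From mathcomp Require Import finmap.
From mathcomp Require Import all_classical.

Set Implicit Arguments.
Unset Strict Implicit.
Unset Printing Implicit Defensive.

Local Open Scope classical_set_scope.

(** Induction on the number of predecessors: if [r u w], transitivity puts those of [u] among those
    of [w], and the inclusion is strict because [u] is one of the latter but, by irreflexivity, not
    one of the former. *)
Lemma finite_predecessors_wf (T : choiceType) (r : T -> T -> Prop) :
  (forall u, ~ r u u) -> (forall u v w, r u v -> r v w -> r u w) ->
  (forall w, finite_set [set u | r u w]) -> well_founded r.
Proof.
move=> irr trans fin w.
have [n] := ubnP #|` fset_set [set u | r u w]|.
elim: n w => [w|n IH w]; first by rewrite ltn0.
rewrite ltnS => lewn.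
constructor=> u ruw; apply: IH; apply: leq_trans lewn.
apply: fproper_ltn_card; rewrite fproperE; apply/andP; split.
  apply/fsubsetP=> v.
  rewrite !in_fset_set // !inE => rvu.
  exact: (trans _ _ _ rvu ruw).
apply/fsubsetPn; exists u; rewrite in_fset_set //.
  exact: mem_set.
by rewrite notin_setE; apply: irr.
Qed.

(** The maximum of the individual stages works; this will give one stage that settles all
    predecessors of a word at once. *)
Lemma finite_uniform_stage (T : choiceType) (A : set T) (P : T -> nat -> Prop) :
  finite_set A ->
  (forall x m n, (m <= n)%N -> P x m -> P x n) ->
  (forall x, A x -> exists n, P x n) ->
  exists n, forall x, A x -> P x n.
Proof.
move=> /finite_seqP[s ->] Pmono; elim: s => [_|a s IH ex]; first by exists 0.
have [x xs|n Pn] := IH; first by apply: ex; rewrite /= inE xs orbT.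
have [|m Pm] := ex a; first by rewrite /= inE eqxx.
exists (maxn m n) => x; rewrite /= inE => /orP[/eqP->|xs].
  exact: Pmono (leq_maxl _ _) Pm.
exact: Pmono (leq_maxr _ _) (Pn _ xs).
Qed.

Section MaximalIndependent.
Variables (Sigma : finType) (M : language Sigma) (t : transducer Sigma).
Implicit Types (X Y L : language Sigma) (w x y : seq Sigma).

Lemma timage_tinvE X w :
  timage (tinv t) X w <-> exists2 x, X x & tout t w x.
Proof.
by split=> -[x Xx r]; exists x => //; apply/realizes_tinv.
Qed.

Lemma independentP X :
  independent t X <-> forall x y, X x -> X y -> ~ tout t x y.
Proof.
split=> [indX x y Xx Xy xy|indX].
  (* [False] is convertible to [set0 y], which lets the set equation [indX] be rewritten
     backwards. *)
  by rewrite -[False]/(set0 y) -indX; split=> //; exists x.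
by rewrite /independent -subset0 => y [[x Xx xy] /(indX _ _ Xx)].
Qed.

Lemma indep_extP X w :
  indep_ext M t X w <->
  M w /\ forall x, X x -> ~ tout t x w /\ ~ tout t w x.
Proof.
split=> [[Mw nw]|[Mw nw]]; split=> //.
  move=> x Xx; split=> r; apply: nw; first by left; exists x.
  by right; apply/timage_tinvE; exists x.
by case=> [[x /nw[]]|/timage_tinvE[x /nw[]]].
Qed.

Lemma muP X w :
  mu M t X w <->
  indep_ext M t X w /\ forall x, indep_ext M t X x -> ~ tout t w x.
Proof.
split=> -[Iw nw]; split=> //.
  by move=> x Ix r; apply: nw; apply/timage_tinvE; exists x.
by case/timage_tinvE=> x /nw.
Qed.

Lemma sub_indep_ext X Y :
  X `<=` Y -> indep_ext M t Y `<=` indep_ext M t X.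
Proof.
by move=> XY w /indep_extP[Mw nw]; apply/indep_extP; split=> // x /XY /nw.
Qed.

Lemma mu_sub X : mu M t X `<=` M.
Proof. by move=> w [[]]. Qed.

(** Any [X] will do: [mu] keeps only words of [indep_ext M t X] that have no output in that set. *)
Lemma mu_independent X : independent t (mu M t X).
Proof. by apply/independentP => x y /muP[_ nx] /muP[/nx]. Qed.

(** Independence puts [X] inside [indep_ext M t X]. No word of the latter is an output of a word of
    [X], so the subtraction in [mu] removes nothing from [X]. *)
Lemma sub_mu X : X `<=` M -> independent t X -> X `<=` mu M t X.
Proof.
move=> XM /independentP indX w Xw; apply/muP; split.
  apply/indep_extP; split; first exact: XM.
  by move=> x Xx; split; apply: indX.
by move=> x /indep_extP[_ /(_ w Xw)[]].
Qed.

Section Iterates.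
Variable L : language Sigma.
Hypotheses (LM : L `<=` M) (indL : independent t L).

Lemma iter_mu_sub n : iter n (mu M t) L `<=` M.
Proof. by case: n => // n; apply: mu_sub. Qed.

Lemma iter_mu_independent n : independent t (iter n (mu M t) L).
Proof. by case: n => // n; apply: mu_independent. Qed.

Lemma iter_mu_homo m n :
  (m <= n)%N -> iter m (mu M t) L `<=` iter n (mu M t) L.
Proof.
move=> /subnK <-; elim: (n - m)%N => // k IH w /IH.
exact: sub_mu (@iter_mu_sub _) (@iter_mu_independent _) w.
Qed.

(** Words outside [M] are settled at every stage by the second alternative, so the induction can
    range over all words. *)
Definition settled w n : Prop :=
  iter n (mu M t) L w \/ ~ indep_ext M t (iter n (mu M t) L) w.

(** Both alternatives persist: the iterates increase, and [indep_ext] is antitone. *)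
Lemma settled_mono w m n : (m <= n)%N -> settled w m -> settled w n.
Proof.
move=> mn [Lw|nIw]; [left; exact: iter_mu_homo mn _ Lw | right].
by move=> Iw; apply: nIw; apply: sub_indep_ext Iw; apply: iter_mu_homo.
Qed.

Lemma settledS w n :
  (forall z, tout t w z -> settled z n) -> settled w n.+1.
Proof.
move=> sett.
have [Iw|nIw] := pselect (indep_ext M t (iter n (mu M t) L) w); last first.
  by apply: (settled_mono (leqnSn n)); right.
left; apply/muP; split=> // z Iz wz.
have [Lz|//] := sett z wz.
by have /indep_extP[_ /(_ z Lz)[]] := Iw.
Qed.

Lemma exists_settled (prec : seq Sigma -> seq Sigma -> Prop) :
  strict_total_order prec -> has_positions prec -> input_decreasing prec t ->
  forall w, exists n, settled w n.
Proof.
move=> [irr trans _] pos dec.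
apply: (well_founded_ind (finite_predecessors_wf irr trans pos)) => w IH.
have [n sett] := finite_uniform_stage (pos w) settled_mono IH.
by exists n.+1; apply: settledS => z /dec /sett.
Qed.

(** Two words of the union already lie in a common iterate, which is independent. *)
Lemma mu_star_independent : independent t (mu_star M t L).
Proof.
apply/independentP => x y [m _ Lx] [n _ Ly].
have /independentP := iter_mu_independent (maxn m n); apply.
  exact: iter_mu_homo (leq_maxl _ _) _ Lx.
exact: iter_mu_homo (leq_maxr _ _) _ Ly.
Qed.

End Iterates.
End MaximalIndependent.

Theorem theorem18 (Sigma : finType) (hSigma : (0 < #|Sigma|)%N)
  (prec : seq Sigma -> seq Sigma -> Prop)
  (hprec : strict_total_order prec) (hpos : has_positions prec)
  (M : language Sigma) (t : transducer Sigma)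
  (ht : input_decreasing prec t)
  (L : language Sigma) (hLM : L `<=` M) (hL : independent t L) :
  L `<=` mu_star M t L /\ maximal_independent M t (mu_star M t L).
Proof.
split; first by move=> w Lw; exists 0.
split.
- by move=> w [n _]; apply: iter_mu_sub.
- exact: mu_star_independent.
move=> w [Mw nLw] /independentP ind.
have [n [Lw|]] := exists_settled hLM hL hprec hpos ht w.
  by apply: nLw; exists n.
(* It remains to contradict the incompatibility of [w] with the [n]-th iterate: that iterate lies in
   [mu_star M t L], and adding [w] to the latter is assumed to keep independence. *)
apply; apply/indep_extP; split=> // x Lx.
have Lsx : (mu_star M t L `|` [set w]) x by left; exists n.
by split; apply: ind => //; right.
Qed.
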